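(* Let $(T,q,t,w)$ be basic data whose rule $w$ has invertible corners. Say that $\mu\in\Lambda^m$ and $\nu\in\Lambda^n$ are composable if $s(\mu)=r(\nu)$, and in that case let the composition $\mu\nu$ be the unique path $\lambda\in\Lambda^{m+n}$ satisfying $\lambda(0,m)=\mu$ and $\lambda(m,m+n)=\nu$. Define $d(\lambda)=n$ for $\lambda\in\Lambda^n$. Then, with objects $\Lambda^0$, morphisms $\Lambda^*=\bigcup_{n\in\mathbb N^2}\Lambda^n$, and range and source maps $r,s$, the pair $\Lambda(T,q,t,w):=((\Lambda^0,\Lambda^*,r,s),d)$ is a $2$-graph.
   Context: $\mathbb N=\{0,1,2,\dots\}$; $e_1,e_2$ is the usual basis of $\mathbb Z^2$; $m\le n$ in $\mathbb Z^2$ is meant coordinatewise. A tile is a finite subset $T\subset\mathbb N^2$ containing $0$ which is hereditary ($j\in T$ and $0\le i\le j$ imply $i\in T$). Basic data $(T,q,t,w)$ consist of a tile $T$, an integer $q\ge 2$, an element $t\in\mathbb Z/q\mathbb Z$ (the trace) and a function $w:T\to\mathbb Z/q\mathbb Z$ (the rule). Let $(c_1,c_2)$ be the coordinatewise maximum of the elements of $T$. The rule $w$ has invertible corners if $w(c_1e_1)$ and $w(c_2e_2)$ are invertible in the ring $\mathbb Z/q\mathbb Z$. The vertex set is $\Lambda^0=\{v:T\to\mathbb Z/q\mathbb Z:\sum_{i\in T}w(i)v(i)=t\}$. For $n\in\mathbb N^2$ put $T(n)=\bigcup_{0\le m\le n}(T+m)$. If $f$ is a $\mathbb Z/q\mathbb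 Z$-valued function whose domain contains $T+n$, define $f|_{T+n}:T\to\mathbb Z/q\mathbb Z$ by $f|_{T+n}(i)=f(i+n)$. A path of degree $n$ is a function $\lambda:T(n)\to\mathbb Z/q\mathbb Z$ such that $\lambda|_{T+m}\in\Lambda^0$ for all $0\le m\le n$; $\Lambda^n$ is the set of these (consistent with $\Lambda^0$ for $n=0$). The source and range of $\lambda\in\Lambda^n$ are $s(\lambda)=\lambda|_{T+n}$ and $r(\lambda)=\lambda|_T$. For $\lambda\in\Lambda^p$ and $0\le m\le n\le p$, the segment $\lambda(m,n)\in\Lambda^{n-m}$ is $\lambda(m,n)(i)=\lambda(m+i)$ for $i\in T(n-m)$. (When $w$ has invertible corners, the path $\lambda$ defining the composition exists and is unique.) A $2$-graph is a countable category $\Lambda$ with a functor $d:\Lambda\to\mathbb N^2$ (where $\mathbb N^2$ is viewed as a category with one object and composition given by addition) satisfying the factorisation property: whenever $d(\lambda)=m+n$ with $m,n\in\mathbb N^2$, there are unique $\mu,\nu\in\Lambda$ with $d(\mu)=m$, $d(\nu)=n$ and $\lambda=\mu\nu$. *)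

(* Defs.v *)
From HB Require Import structures.
From mathcomp Require Import all_boot all_order all_algebra finmap.
From mathcomp Require Import boolp classical_sets functions cardinality.

Set Implicit Arguments.
Unset Strict Implicit.
Unset Printing Implicit Defensive.

Import GRing.Theory.
Local Open Scope fset_scope.
Local Open Scope fmap_scope.
Local Open Scope ring_scope.

(* Addition and 0 on N2 are those of the product nmodType structure. *)
Notation N2 := (nat * nat)%type.

Definition leN2 (m n : N2) : Prop := (m.1 <= n.1)%N /\ (m.2 <= n.2)%N.

Lemma leN2_0 (n : N2) : leN2 0 n.
Proof. by []. Qed.

Lemma leN2_refl (n : N2) : leN2 n n.
Proof. by []. Qed.

(* Truncated; only used for m <= n. *)
Definition subN2 (n m : N2) : N2 := ((n.1 - m.1)%N, (n.2 - m.2)%N).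

(* [comp e], for e : src f = rng g, is the composite written fg. *)
Record category_data := CategoryData {
  obj : Type;
  mor : Type;
  rng : mor -> obj;
  src : mor -> obj;
  ident : obj -> mor;
  comp : forall f g : mor, src f = rng g -> mor }.

Record is_category (C : category_data) : Prop := IsCategory {
  rng_ident : forall v : obj C, rng (ident v) = v;
  src_ident : forall v : obj C, src (ident v) = v;
  rng_comp : forall (f g : mor C) (e : src f = rng g), rng (comp e) = rng f;
  src_comp : forall (f g : mor C) (e : src f = rng g), src (comp e) = src g;
  comp_ident_l : forall (f : mor C) (e : src (ident (rng f)) = rng f),
    comp e = f;
  comp_ident_r : forall (f : mor C) (e : src f = rng (ident (src f))),
    comp e = f;
  comp_assoc : forall (f g h : mor C) (fg : src f = rng g) (gh : src g = rng h)
    (fg_h : src (comp fg) = rng h) (f_gh : src f = rng (comp gh)),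
    comp fg_h = comp f_gh }.

Record is_two_graph (C : category_data) (d : mor C -> N2) : Prop := IsTwoGraph {
  two_graph_category : is_category C;
  two_graph_countable : countable [set: mor C]%classic;
  degree_ident : forall v : obj C, d (ident v) = 0;
  degree_comp : forall (f g : mor C) (e : src f = rng g),
    d (comp e) = d f + d g;
  factorisation : forall (l : mor C) (m n : N2), d l = m + n ->
    exists! p : mor C * mor C,
      [/\ d p.1 = m, d p.2 = n &
          exists e : src p.1 = rng p.2, l = comp e] }.

Definition is_tile (T : {fset N2}) : Prop :=
  0 \in T /\ forall i j : N2, j \in T -> leN2 i j -> i \in T.

(* A function A -> Z/q on a finite set A of N2 is a finite map f with
   [domf f = A].  Evaluation is only used at points of the domain; its value 0
   elsewhere is irrelevant. *)
Definition ev (q : nat) (f : {fmap N2 -> 'Z_q}) (i : N2) : 'Z_q :=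
  odflt 0 f.[? i].

Definition basic_data (T : {fset N2}) (q : nat) (t : 'Z_q)
    (w : {fmap N2 -> 'Z_q}) : Prop :=
  [/\ is_tile T, (2 <= q)%N & domf w = T].

Definition invertible_corners (T : {fset N2}) (q : nat)
    (w : {fmap N2 -> 'Z_q}) : Prop :=
  let c1 := (\max_(i <- T) i.1)%N in
  let c2 := (\max_(i <- T) i.2)%N in
  ev w (c1, 0%N) \is a GRing.unit /\ ev w (0%N, c2) \is a GRing.unit.

Definition interval0 (n : N2) : seq N2 :=
  [seq (a, b) | a <- iota 0 n.1.+1, b <- iota 0 n.2.+1].

Lemma mem_interval0 (m n : N2) : m \in interval0 n <-> leN2 m n.
Proof.
case: m n => [a b] [c d]; split.
  by case/allpairsP => -[x y] []; rewrite !mem_iota => ? ? [-> ->].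
by move=> [ac bd]; apply/allpairsP; exists (a, b); rewrite !mem_iota.
Qed.

(* T(n), the union of the translates T + m for 0 <= m <= n. *)
Definition extent (T : {fset N2}) (n : N2) : {fset N2} :=
  (\bigcup_(m <- interval0 n) [fset (i + m)%R | i in T])%fset.

Lemma in_extent (T : {fset N2}) (n j : N2) :
  j \in extent T n <-> exists i m : N2, [/\ i \in T, leN2 m n & j = i + m].
Proof.
split=> [/bigfcupP[m /andP[/mem_interval0 mn _] /imfsetP[i /= iT ->]]|].
  by exists i, m.
move=> [i [m [iT /mem_interval0 mn ->]]]; apply/bigfcupP; exists m.
  by rewrite mn.
by apply/imfsetP; exists i.
Qed.

(* f|_{T+n} *)
Definition window (T : {fset N2}) (q : nat) (f : {fmap N2 -> 'Z_q}) (n : N2) :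
  {fmap N2 -> 'Z_q} := [fmap i : T => ev f (val i + n)].

(* f(m, n) *)
Definition segment (T : {fset N2}) (q : nat) (f : {fmap N2 -> 'Z_q})
  (m n : N2) : {fmap N2 -> 'Z_q} :=
  [fmap i : extent T (subN2 n m) => ev f (m + val i)].

Section Paths.
Variables (T : {fset N2}) (q : nat) (t : 'Z_q) (w : {fmap N2 -> 'Z_q}).

Definition is_vertex (v : {fmap N2 -> 'Z_q}) : Prop :=
  domf v = T /\ \sum_(i <- T) ev w i * ev v i = t.

Definition is_path (n : N2) (f : {fmap N2 -> 'Z_q}) : Prop :=
  domf f = extent T n /\
  forall m : N2, leN2 m n -> is_vertex (window T f m).

Record vertex := Vertex {
  vertex_fun :> {fmap N2 -> 'Z_q};
  vertexP : is_vertex vertex_fun }.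

(* For T nonempty, [extent T n] determines n, so the union over n of the sets
   of paths of degree n is a disjoint union. *)
Record tile_path := Path {
  degree : N2;
  path_fun :> {fmap N2 -> 'Z_q};
  pathP : is_path degree path_fun }.

Lemma vertex_fun_inj : injective vertex_fun.
Proof.
by move=> [f hf] [g hg] /= e; subst g; congr Vertex; exact: Prop_irrelevance.
Qed.

Lemma path_inj (l l' : tile_path) :
  degree l = degree l' -> path_fun l = path_fun l' -> l = l'.
Proof.
case: l l' => [n f hf] [n' g hg] /= en e; subst n' g.
by congr Path; exact: Prop_irrelevance.
Qed.

HB.instance Definition _ := gen_eqMixin tile_path.
HB.instance Definition _ := gen_choiceMixin tile_path.

Definition path_range (l : tile_path) : vertex := Vertex ((pathP l).2 _ (leN2_0 _)).

Definition path_source (l : tile_path) : vertex :=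
  Vertex ((pathP l).2 _ (leN2_refl _)).

Lemma extent0 : extent T 0 = T.
Proof.
apply/fsetP => j; apply/idP/idP => [|jT].
  by case/in_extent => i [[[|a] [|b]] [iT []]] // _ _ ->; rewrite (addr0 i).
by apply/in_extent; exists j, 0; split=> //; rewrite addr0.
Qed.

Lemma window0 (v : {fmap N2 -> 'Z_q}) : domf v = T -> window T v 0 = v.
Proof.
move=> dv; apply/fmapP => i; case: (boolP (i \in T)) => iT.
  have iv : i \in domf v by rewrite dv.
  have iw : i \in domf (window T v 0) by [].
  by rewrite in_fnd ffunE /= addr0 /ev in_fnd.
have iv : i \notin domf v by rewrite dv.
by rewrite !not_fnd.
Qed.

Lemma vertex_is_path (v : vertex) : is_path 0 v.
Proof.
case: v => v [dv sv]; split; first by rewrite extent0.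
move=> [[|a] [|b]] [] //= _ _.
by have -> : window T v (0%N, 0%N) = v by exact: window0.
Qed.

(* The identity at v is v itself, as a path of degree 0. *)
Definition vertex_path (v : vertex) : tile_path := Path (vertex_is_path v).

Definition is_composition (mu nu l : tile_path) : Prop :=
  [/\ degree l = degree mu + degree nu,
      segment T l 0 (degree mu) = mu &
      segment T l (degree mu) (degree mu + degree nu) = nu].

(* The default value mu is used only if no such path exists. *)
Definition composition (mu nu : tile_path) : tile_path :=
  xget mu [set l | is_composition mu nu l]%classic.

Definition path_category : category_data :=
  @CategoryData vertex tile_path path_range path_source vertex_path
    (fun mu nu _ => composition mu nu).

End Paths.

(* Main.v *)
Require Import Defs.
From HB Require Import structures.
From mathcomp Require Import all_boot all_order all_algebra finmap zify.
From mathcomp Require Import boolp classical_sets functions cardinality.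

Set Implicit Arguments.
Unset Strict Implicit.
Unset Printing Implicit Defensive.

(** Let mu and nu have degrees m and n, with s(mu) = r(nu).  By heredity T(m)
    and m + T(n) overlap exactly in m + T, where mu and nu agree, so the two
    prescribe a function on the windows p <= m and p >= m.  The other windows
    p <= m + n lie to the lower right or to the upper left of m.  Treated in
    order of increasing distance to m, each of them has exactly one entry not
    yet known, at p + c1 e1 resp. p + c2 e2; the rule determines it because
    w(c1 e1) and w(c2 e2) are invertible.  So the composite exists and is unique,
    and the category axioms and the factorisation property follow by comparing
    segments. *)

Section TilePaths.
Import GRing.Theory.
Local Open Scope ring_scope.

(** * Coordinatewise arithmetic and order on [N2] *)

Lemma N2_addI (p i j : N2) : (i + p == j + p) = (i == j).
Proof. by case: p i j => [a b] [c d] [e f]; rewrite !xpair_eqE !eqn_add2r. Qed.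

Lemma subN2_0 (n : N2) : subN2 n 0 = n.
Proof. by case: n => [a b]; congr pair; exact: subn0. Qed.

Lemma N2_addKC (m n : N2) : subN2 (m + n) m = n.
Proof. by case: m n => [a b] [c d]; congr pair; rewrite /= addKn. Qed.

Lemma N2_subKC (m n : N2) : leN2 m n -> m + subN2 n m = n.
Proof. by case: m n => [a b] [c d] [h1 h2]; congr pair; exact: subnKC. Qed.

Lemma leN2_addr (m n : N2) : leN2 m (m + n).
Proof. by split; apply: leq_addr. Qed.

Lemma leN2_trans (m n p : N2) : leN2 n p -> leN2 m n -> leN2 m p.
Proof.
by move=> [h1 h2] [h3 h4]; split; [apply: leq_trans h1|apply: leq_trans h2].
Qed.

Lemma leN2_add2l (m n p : N2) : leN2 n p -> leN2 (m + n) (m + p).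
Proof. by move=> [h1 h2]; split; rewrite leq_add2l. Qed.

(** * Finite maps, windows and segments, and the rule as a linear equation *)

Section FiniteMaps.
Variable q : nat.
Implicit Type f : {fmap N2 -> 'Z_q}.

Lemma ev_fmap (A : {fset N2}) (F : N2 -> 'Z_q) (i : N2) :
  i \in A -> ev [fmap j : A => F (val j)] i = F i.
Proof. by move=> iA; rewrite /ev in_fnd ffunE. Qed.

Lemma ev_out f (i : N2) : i \notin domf f -> ev f i = 0.
Proof. by move=> iF; rewrite /ev not_fnd. Qed.

Lemma ev_ext f g : domf f = domf g -> {in domf f, ev f =1 ev g} -> f = g.
Proof.
move=> dfg h; apply/fmapP => i; case: (boolP (i \in domf f)) => iF; last first.
  have iG : i \notin domf g by rewrite -dfg.
  by rewrite !not_fnd.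
have iG : i \in domf g by rewrite -dfg.
by move: (h _ iF); rewrite /ev !in_fnd /= => ->.
Qed.

Variable T : {fset N2}.

Lemma ev_window f (n i : N2) : i \in T -> ev (window T f n) i = ev f (i + n).
Proof. exact: (ev_fmap (fun i => ev f (i + n))). Qed.

Lemma ev_segment f (m n i : N2) :
  i \in extent T (subN2 n m) -> ev (segment T f m n) i = ev f (m + i).
Proof. exact: (ev_fmap (fun i => ev f (m + i))). Qed.

Lemma extent_add (n i m : N2) : i \in T -> leN2 m n -> i + m \in extent T n.
Proof. by move=> iT mn; apply/in_extent; exists i, m. Qed.

Lemma extentS (m n : N2) : leN2 m n -> {subset extent T m <= extent T n}.
Proof.
move=> mn j /in_extent [i [p [iT pm ->]]].
by apply: extent_add => //; apply: leN2_trans pm.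
Qed.

Lemma sub_extent (n : N2) : {subset T <= extent T n}.
Proof. by move=> i iT; rewrite -(addr0 i); apply: extent_add. Qed.

Lemma extent_shift (m n i : N2) : i \in extent T n -> m + i \in extent T (m + n).
Proof.
move=> /in_extent [j [p [jT pn ->]]]; rewrite addrCA.
by apply: extent_add => //; apply: leN2_add2l.
Qed.

Variables (t : 'Z_q) (w : {fmap N2 -> 'Z_q}).

(** The left side of the rule at [p]. Taking [u] total lets single entries be altered before the
    function is restricted to an extent. *)
Definition window_sum (u : N2 -> 'Z_q) (p : N2) : 'Z_q :=
  \sum_(i <- T) ev w i * u (i + p).

Lemma window_sum_eq (u v : N2 -> 'Z_q) (p r : N2) :
  {in T, forall i, u (i + p) = v (i + r)} -> window_sum u p = window_sum v r.
Proof. by move=> h; apply: eq_big_seq => i iT; rewrite h. Qed.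

Lemma is_vertex_window f (p : N2) :
  is_vertex T t w (window T f p) <-> window_sum (ev f) p = t.
Proof.
have -> : window_sum (ev f) p = \sum_(i <- T) ev w i * ev (window T f p) i.
  by apply: eq_big_seq => i iT; rewrite ev_window.
by split=> [[]|].
Qed.

Lemma path_sum (l : tile_path T t w) (p : N2) :
  leN2 p (degree l) -> window_sum (ev l) p = t.
Proof. by move=> pl; apply/is_vertex_window; apply: (Defs.pathP l).2. Qed.

Lemma path_domf (l : tile_path T t w) : domf (path_fun l) = extent T (degree l).
Proof. exact: (Defs.pathP l).1. Qed.

Lemma path_ext (l l' : tile_path T t w) : degree l = degree l' ->
  {in extent T (degree l), ev l =1 ev l'} -> l = l'.
Proof.
move=> d h; apply: path_inj => //.
by apply: ev_ext; [rewrite !path_domf d|rewrite path_domf].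
Qed.

Lemma vertex_ext (v v' : vertex T t w) : {in T, ev v =1 ev v'} -> v = v'.
Proof.
move=> h; apply: vertex_fun_inj; apply: ev_ext; rewrite (vertexP v).1 //.
by rewrite (vertexP v').1.
Qed.

Lemma ev_range (l : tile_path T t w) : {in T, ev (path_range l) =1 ev l}.
Proof. by move=> i iT; rewrite ev_window // addr0. Qed.

Lemma ev_source (l : tile_path T t w) :
  {in T, forall i, ev (path_source l) i = ev l (i + degree l)}.
Proof. by move=> i iT; rewrite ev_window. Qed.

Lemma segment_is_path (l : tile_path T t w) (m n : N2) :
  leN2 m n -> leN2 n (degree l) ->
  is_path T t w (subN2 n m) (segment T l m n).
Proof.
move=> mn nl; split=> // p pnm; apply/is_vertex_window.
transitivity (window_sum (ev l) (m + p)).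
  apply: window_sum_eq => i iT; rewrite ev_segment 1?addrCA //.
  exact: extent_add.
apply: path_sum; apply: leN2_trans nl _.
by rewrite -(N2_subKC mn); apply: leN2_add2l.
Qed.

Definition segment_path (l : tile_path T t w) (m n : N2)
  (mn : leN2 m n) (nl : leN2 n (degree l)) : tile_path T t w :=
  Path (segment_is_path mn nl).

(** Trades equality of finite maps for pointwise equations, the form in which composites are built
    and compared. *)
Lemma is_compositionP (mu nu l : tile_path T t w) :
  is_composition mu nu l <->
  [/\ degree l = degree mu + degree nu,
      {in extent T (degree mu), ev l =1 ev mu} &
      {in extent T (degree nu), forall i, ev l (degree mu + i) = ev nu i}].
Proof.
split=> [[d hmu hnu]|[d hmu hnu]]; split=> //.
- by move=> i iT; rewrite -hmu ev_segment ?add0r // subN2_0.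
- by move=> i iT; rewrite -hnu ev_segment // N2_addKC.
- apply: ev_ext; rewrite ?path_domf /= subN2_0 // => i iT.
  by rewrite ev_segment ?add0r ?subN2_0 ?hmu.
- apply: ev_ext; rewrite ?path_domf /= N2_addKC // => i iT.
  by rewrite ev_segment ?N2_addKC ?hnu.
Qed.

(* Each newly solved window has an entry with invertible weight that no earlier
   window contains, so changing that entry spoils no earlier equation. *)
Lemma triangular_solve (k : N2 -> N2) (s : seq N2) (u : N2 -> 'Z_q) :
  (forall p, p \in s -> k p \in T /\ ev w (k p) \is a GRing.unit) ->
  pairwise (fun p' p => all (fun i => i + p' != k p + p) T) s ->
  exists v : N2 -> 'Z_q,
    (forall j, (forall p, p \in s -> j != k p + p) -> v j = u j) /\
    (forall p, p \in s -> window_sum v p = t).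
Proof.
elim/last_ind: s => [|s p IH] hk; first by exists u.
rewrite pairwise_rcons => /andP[/allP hp /IH[]].
  by move=> r rs; apply: hk; rewrite mem_rcons inE rs orbT.
move=> v [vu vs].
have [kT kU] : k p \in T /\ ev w (k p) \is a GRing.unit.
  by apply: hk; rewrite mem_rcons inE eqxx.
(* The defect of the equation at [p], divided by the weight of the entry that absorbs it. *)
pose d := (t - window_sum v p) / ev w (k p).
exists (fun j => v j + (j == k p + p)%:R * d); split.
  move=> j hj; rewrite vu => [|r rs]; last by rewrite hj ?mem_rcons ?inE ?rs ?orbT.
  have -> : (j == k p + p) = false by apply/negbTE/hj; rewrite mem_rcons mem_head.
  by rewrite mul0r addr0.
move=> r; rewrite mem_rcons inE => /predU1P[->|rs]; last first.
  rewrite -(vs _ rs); apply: window_sum_eq => i iT.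
  by rewrite (negbTE (allP (hp _ rs) _ iT)) mul0r addr0.
rewrite /window_sum; under eq_bigr do rewrite mulrDr N2_addI.
rewrite big_split /= -/(window_sum v p) (bigD1_seq (k p)) ?fset_uniq //= eqxx mul1r.
rewrite big1 => [|i /negbTE ->]; last by rewrite mul0r mulr0.
by rewrite addr0 mulrC divrK // addrC subrK.
Qed.

(** The terms off [k] cancel, and then so does the invertible weight [ev w k]. *)
Lemma unique_entry (u v : N2 -> 'Z_q) (k p : N2) :
  k \in T -> ev w k \is a GRing.unit -> window_sum u p = window_sum v p ->
  {in T, forall i, i != k -> u (i + p) = v (i + p)} -> u (k + p) = v (k + p).
Proof.
move=> kT kU; rewrite /window_sum !(bigD1_seq k) ?fset_uniq //= => huv h.
apply: (mulrI kU); move: huv.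
rewrite big_seq_cond [X in _ = _ + X]big_seq_cond.
have -> : \sum_(i <- T | (i \in T) && (i != k)) ev w i * u (i + p) =
    \sum_(i <- T | (i \in T) && (i != k)) ev w i * v (i + p).
  by apply: eq_bigr => i /andP[iT ik]; rewrite h.
exact: addIr.
Qed.

End FiniteMaps.

(** * Corners, and the position of windows relative to [m] *)

Section InvertibleCorners.
Variables (T : {fset N2}) (q : nat) (t : 'Z_q) (w : {fmap N2 -> 'Z_q}).
Hypothesis tileT : is_tile T.
Hypothesis domw : domf w = T.
Hypothesis cornersw : invertible_corners T w.

Let c1 := (\max_(i <- T) i.1)%N.
Let c2 := (\max_(i <- T) i.2)%N.

Lemma tile_le (i j : N2) : j \in T -> leN2 i j -> i \in T.
Proof. exact: tileT.2. Qed.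

Lemma tile_max (i : N2) : i \in T -> leN2 i (c1, c2).
Proof.
move=> iT; split.
  exact: (@leq_bigmax_seq _ _ xpredT (fun i : N2 => i.1) i iT).
exact: (@leq_bigmax_seq _ _ xpredT (fun i : N2 => i.2) i iT).
Qed.

(** Outside its domain [w] evaluates to the default 0, which is not a unit. *)
Lemma unit_in_tile (i : N2) : ev w i \is a GRing.unit -> i \in T.
Proof. by rewrite -domw; apply: contraLR => /ev_out ->; rewrite unitr0. Qed.

(* Windows at p with m.1 < p.1 and p.2 < m.2 are solved for their lower right
   corner, those with p.1 < m.1 and m.2 < p.2 for their upper left one. *)
Definition corner (m p : N2) : N2 :=
  if (m.1 < p.1)%N then (c1, 0%N) else (0%N, c2).

Lemma cornerP (m p : N2) :
  corner m p \in T /\ ev w (corner m p) \is a GRing.unit.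
Proof.
have [h1 h2] := cornersw.
by rewrite /corner; case: ifP => _; split=> //; apply: unit_in_tile.
Qed.

(** Subtraction is truncated, so in each coordinate one of the two differences vanishes and the
    other is the absolute difference. *)
Definition l1dist (m p : N2) : nat :=
  ((p.1 - m.1) + (m.1 - p.1) + ((p.2 - m.2) + (m.2 - p.2)))%N.

Definition incomparable (m p : N2) : bool :=
  (m.1 < p.1)%N && (p.2 < m.2)%N || (p.1 < m.1)%N && (m.2 < p.2)%N.

Lemma comparableP (m p : N2) : [\/ leN2 p m, leN2 m p | incomparable m p].
Proof.
case: m p => [a b] [c d]; rewrite /incomparable /leN2 /=.
have : [|| (c <= a)%N && (d <= b)%N, (a <= c)%N && (b <= d)%N |
           (a < c)%N && (d < b)%N || (c < a)%N && (b < d)%N] by lia.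
by case/or3P => [/andP|/andP|] h; [apply: Or31|apply: Or32|apply: Or33].
Qed.

(** If [p] is to the lower right of [m], a window [p'] meeting the corner entry of [p] has
    [p.1 <= p'.1] and [p'.2 <= p.2], hence is at least as far from [m], with equality only for
    [p' = p]. The upper left case is symmetric. *)
Lemma corner_fresh (m p p' i : N2) :
  incomparable m p -> incomparable m p' ->
  (l1dist m p' <= l1dist m p)%N -> i \in T -> i + p' = corner m p + p -> p' = p.
Proof.
move=> + + + /tile_max [].
case: m p p' i => [a b] [x y] [x' y'] [i j].
rewrite /incomparable /l1dist /corner /=.
move=> + + + hi hj; case: ifP => h0 h1 h2 h3 [e1 e2]; congr pair.
all: move: h0 h1 h2 h3 e1 e2; rewrite /GRing.add /=; lia.
Qed.

(** Windows below [m] stay within [m + (c1, c2)]; the corner entry of [p] exceeds this bound in one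
    coordinate. *)
Lemma corner_notin_base (m p i p' : N2) :
  incomparable m p -> i \in T -> leN2 p' m -> i + p' != corner m p + p.
Proof.
move=> + /tile_max [].
case: m p p' i => [a b] [x y] [x' y'] [i j]; rewrite /incomparable /corner /=.
move=> + hi hj [+ +] /=; case: ifP => h0 h1 h2 h3; apply/eqP => -[].
all: move: h0 h1 h2 h3; rewrite /GRing.add /=; lia.
Qed.

(** The corner entry keeps the coordinate in which [p] is smaller than [m]. *)
Lemma corner_notin_shift (m p j : N2) :
  incomparable m p -> m + j != corner m p + p.
Proof.
case: m p j => [a b] [x y] [i j]; rewrite /incomparable /corner /=.
case: ifP => h0 h1; apply/eqP => -[].
all: move: h0 h1; rewrite /GRing.add /=; lia.
Qed.

(** By induction on the distance to [m]: the non-corner entries of a window lie in nearer windows,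
    and the rule then forces the corner. *)
Lemma window_uniqueness (m n : N2) (u v : N2 -> 'Z_q) :
  (forall p, leN2 p n -> window_sum T w u p = t) ->
  (forall p, leN2 p n -> window_sum T w v p = t) ->
  (forall i p, i \in T -> leN2 p n -> leN2 p m \/ leN2 m p ->
     u (i + p) = v (i + p)) ->
  leN2 m n ->
  {in extent T n, u =1 v}.
Proof.
move=> hu hv base mn j /in_extent[i [p [iT pn ->]]] {j}.
have [N] := ubnP (l1dist m p); elim: N => // N IH in p pn i iT *.
rewrite ltnS => hN; case: (comparableP m p) => [pm|mp|bad].
- by apply: base => //; left.
- by apply: base => //; right.
have [kT kU] := cornerP m p.
have other i' : i' \in T -> i' != corner m p -> u (i' + p) = v (i' + p).
  move=> iT' ne.
  have bnd := tile_max iT'.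
  suff [i2 [p2 [i2T p2n lt ->]]] : exists i2 p2 : N2,
      [/\ i2 \in T, leN2 p2 n, (l1dist m p2 < l1dist m p)%N & i' + p = i2 + p2].
    by apply: IH => //; apply: leq_trans hN.
  (* The sample arguments select the two branches of [corner], putting [(c1, 0)] and [(0, c2)] in
     [T]. *)
  have hc1 := (cornerP (0%N, 0%N) (1%N, 0%N)).1.
  have hc2 := (cornerP (0%N, 0%N) (0%N, 1%N)).1.
  move: ne iT' bnd pn mn bad hc1 hc2 {kT kU hN IH iT hu hv base}.
  rewrite /incomparable /corner /l1dist /leN2 /=.
  case: i' p m n => [x y] [a b] [m1 m2] [n1 n2] /=.
  (* To the lower right of [m], an entry in the bottom row of the window belongs to the window one
     step left, any other entry to the window one step up. To the upper left, the steps are down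
     (first column) and right. Heredity keeps the shifted index in [T]. *)
  have [lt|le] := ltnP m1 a => /= ne iT' [hx hy] [an bn] [m1n m2n] bad hc1 hc2.
    case: y ne iT' hy => [|y] ne iT' hy.
      have xc : (x < c1)%N by move: ne; rewrite xpair_eqE eqxx andbT; lia.
      exists (x.+1, 0%N), (a.-1, b); split=> /=; try lia; last first.
        by congr pair; rewrite /GRing.add /=; lia.
      by apply: tile_le hc1 _; split.
    exists (x, y), (a, b.+1); split=> /=; try lia.
      by apply: tile_le iT' _; split=> /=.
    by congr pair; rewrite /GRing.add /=; lia.
  case: x ne iT' hx => [|x] ne iT' hx.
    have yc : (y < c2)%N by move: ne; rewrite xpair_eqE eqxx; lia.
    exists (0%N, y.+1), (a, b.-1); split=> /=; try lia; last first.
      by congr pair; rewrite /GRing.add /=; lia.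
    by apply: tile_le hc2 _; split.
  exists (x, y), (a.+1, b); split=> /=; try lia.
    by apply: tile_le iT' _; split=> /=.
  by congr pair; rewrite /GRing.add /=; lia.
case: (eqVneq i (corner m p)) => [->|ne]; last exact: other.
by apply: unique_entry kT kU _ other; rewrite hu ?hv.
Qed.

(** * Uniqueness and existence of composites *)

Local Notation tpath := (tile_path T t w).

Lemma composition_unique (mu nu l l' : tpath) :
  is_composition mu nu l -> is_composition mu nu l' -> l = l'.
Proof.
move=> /is_compositionP[d hmu hnu] /is_compositionP[d' hmu' hnu'].
apply: path_ext; first by rewrite d.
rewrite d; apply: (window_uniqueness (m := degree mu)).
- by move=> p pn; apply: path_sum; rewrite d.
- by move=> p pn; apply: path_sum; rewrite d'.
- move=> i p iT pn [pm|mp]; first by rewrite hmu ?hmu' //; apply: extent_add.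
  have -> : i + p = degree mu + (i + subN2 p (degree mu)).
    by rewrite addrCA N2_subKC.
  have : i + subN2 p (degree mu) \in extent T (degree nu).
    apply: extent_add => //; case: pn; rewrite /leN2 /=.
    by rewrite /GRing.add /=; lia.
  by move=> h; rewrite hnu ?hnu'.
- exact: leN2_addr.
Qed.

(** From [m + i = j + p] with [p <= m] follows [i <= j], so heredity applies. *)
Lemma extent_overlap (m i : N2) : m + i \in extent T m -> i \in T.
Proof.
move=> /in_extent[j [p [jT [p1 p2] e]]]; apply: tile_le jT _.
case: m i j p p1 p2 e => [a b] [c d] [e f] [g h] /=.
move=> p1 p2 []; rewrite /leN2 /GRing.add /=; lia.
Qed.

Lemma composition_exists (mu nu : tpath) :
  path_source mu = path_range nu -> exists l, is_composition mu nu l.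
Proof.
move=> e; set m := degree mu; set n := degree nu.
(* Outside T(m) and m + T(n) the values of [u] are arbitrary; the remaining equations are solved
   starting from them. *)
pose u j := if j \in extent T m then ev mu j else ev nu (subN2 j m).
have u_nu : {in extent T n, forall i, u (m + i) = ev nu i}.
  move=> i iT; rewrite /u; case: ifP => [/extent_overlap iT'|_].
    by rewrite -(ev_range nu) // -e ev_source // addrC.
  by rewrite N2_addKC.
pose rel p' p := (l1dist m p' <= l1dist m p)%N.
have rel_total : total rel by move=> p p'; apply: leq_total.
have rel_trans : transitive rel by move=> p p' p''; apply: leq_trans.
pose s := sort rel [seq p <- interval0 (m + n) | incomparable m p].
have mem_s p : (p \in s) = incomparable m p && (p \in interval0 (m + n)).
  by rewrite mem_sort mem_filter.
have uniq_s : uniq s.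
  rewrite sort_uniq filter_uniq //; apply: allpairs_uniq; try exact: iota_uniq.
  by move=> [? ?] [? ?].
(* [corner_fresh] admits ties in distance and concludes [p' = p]; [s] has no repetitions, so this is
   a contradiction. *)
have pw : pairwise (fun p' p => all (fun i => i + p' != corner m p + p) T) s.
  have : pairwise rel s by rewrite -sorted_pairwise // sort_sorted.
  move: uniq_s; rewrite uniq_pairwise => pw1 pw2.
  have : pairwise [rel x y | (x != y) && rel x y] s.
    by rewrite pairwise_relI pw1.
  apply: (@sub_in_pairwise _ (mem s)); last exact/allP.
  move=> p' p; rewrite !mem_s => /andP[b' _] /andP[b _] /andP[ne le].
  apply/allP => i iT; apply: contra ne => /eqP.
  by move/(corner_fresh b b' le iT) => ->.
have [v [vu vs]] := triangular_solve t u (fun p _ => cornerP m p) pw.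
have v_mu : {in extent T m, v =1 ev mu}.
  move=> j jm; rewrite vu ?/u ?jm // => p; rewrite mem_s => /andP[bad _].
  have /in_extent[i [p' [iT pm ->]]] := jm.
  exact: corner_notin_base.
have v_nu : {in extent T n, forall i, v (m + i) = ev nu i}.
  move=> i iT; rewrite vu ?u_nu // => p; rewrite mem_s => /andP[bad _].
  exact: corner_notin_shift.
have lP : is_path T t w (m + n) [fmap i : extent T (m + n) => v (val i)].
  split=> // p pmn; apply/is_vertex_window.
  rewrite (@window_sum_eq _ _ _ _ v _ p); last first.
    by move=> i iT; rewrite ev_fmap //; apply: extent_add.
  case: (comparableP m p) => [pm|mp|bad].
  - rewrite -[RHS](path_sum pm); apply: window_sum_eq => i iT.
    by apply: v_mu; apply: extent_add.
  - have pn : leN2 (subN2 p m) n.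
      by case: pmn; rewrite /leN2 /GRing.add /=; lia.
    rewrite -[RHS](path_sum pn); apply: window_sum_eq => i iT.
    by rewrite -{1}(N2_subKC mp) addrCA v_nu //; apply: extent_add.
  - by apply: vs; rewrite mem_s bad; apply/mem_interval0.
exists (Path lP); apply/is_compositionP; split=> //= i iT.
  by rewrite ev_fmap ?v_mu //; apply: extentS iT; apply: leN2_addr.
by rewrite ev_fmap ?v_nu //; apply: extent_shift.
Qed.

(** Existence rules out the default value in [composition]. *)
Lemma compositionP (mu nu : tpath) : path_source mu = path_range nu ->
  is_composition mu nu (composition mu nu).
Proof. by move=> /composition_exists h; apply: (xgetPex mu h). Qed.

Lemma composition_eq (mu nu l : tpath) :
  path_source mu = path_range nu -> is_composition mu nu l ->
  composition mu nu = l.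
Proof. by move=> /compositionP; apply: composition_unique. Qed.

(** * The category axioms *)

Lemma range_composition (mu nu : tpath) : path_source mu = path_range nu ->
  path_range (composition mu nu) = path_range mu.
Proof.
move=> /compositionP /is_compositionP[_ h _]; apply: vertex_ext => i iT.
by rewrite !ev_range ?h //; apply: sub_extent.
Qed.

Lemma source_composition (mu nu : tpath) : path_source mu = path_range nu ->
  path_source (composition mu nu) = path_source nu.
Proof.
move=> /compositionP /is_compositionP[d _ h]; apply: vertex_ext => i iT.
rewrite !ev_source ?d // addrCA h //; exact: extent_add.
Qed.

Lemma range_vertex_path (v : vertex T t w) : path_range (vertex_path v) = v.
Proof. by apply: vertex_ext => i iT; rewrite ev_range. Qed.

Lemma source_vertex_path (v : vertex T t w) : path_source (vertex_path v) = v.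
Proof. by apply: vertex_ext => i iT; rewrite ev_source //= addr0. Qed.

Lemma composition_vertex_path_l (l : tpath) :
  composition (vertex_path (path_range l)) l = l.
Proof.
apply: composition_eq; first by rewrite source_vertex_path.
apply/is_compositionP; split=> /=; rewrite ?add0r // => i iT.
  by rewrite ev_range //; rewrite extent0 in iT.
by rewrite add0r.
Qed.

Lemma composition_vertex_path_r (l : tpath) :
  composition l (vertex_path (path_source l)) = l.
Proof.
apply: composition_eq; first by rewrite range_vertex_path.
apply/is_compositionP; split=> /=; rewrite ?addr0 // => i iT.
by rewrite ev_source 1?addrC //; rewrite extent0 in iT.
Qed.

(** Let [l] be the left-hand composite. Its segment from [degree f] to the end is a composite of [g]
    and [h], hence the composite by uniqueness; so [l] also composes [f] with it. *)
Lemma compositionA (f g h : tpath) :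
  path_source f = path_range g -> path_source g = path_range h ->
  composition (composition f g) h = composition f (composition g h).
Proof.
move=> fg gh.
have /compositionP Cfg := fg; have /compositionP Cgh := gh.
have /compositionP : path_source (composition f g) = path_range h.
  by rewrite source_composition.
move: (composition f g) Cfg => k Ck; move: (composition k h) => l Cl.
have f_gh : path_source f = path_range (composition g h).
  by rewrite range_composition.
symmetry; apply: composition_eq => //.
have /is_compositionP[dk kf kg] := Ck; have /is_compositionP[dl lk lh] := Cl.
have dl' : degree l = degree f + (degree g + degree h) by rewrite dl dk addrA.
have dgh : degree (composition g h) = degree g + degree h by case: Cgh.
have fl : leN2 (degree f) (degree l) by rewrite dl'; apply: leN2_addr.
pose r := segment_path fl (leN2_refl _).
have dr : degree r = degree g + degree h by rewrite /= dl' N2_addKC.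
have er : {in extent T (degree r), forall i, ev r i = ev l (degree f + i)}.
  by move=> i iT; rewrite ev_segment.
have <- : r = composition g h.
  apply: (composition_unique _ Cgh); apply/is_compositionP; split=> // i iT.
    rewrite er; last by rewrite dr; apply: extentS iT; apply: leN2_addr.
    by rewrite lk ?kg // dk; apply: extent_shift.
  rewrite er; last by rewrite dr; apply: extent_shift.
  by rewrite addrA -dk lh.
apply/is_compositionP; split=> [|i iT|i iT].
- by rewrite dr.
- by rewrite lk ?kf // dk; apply: extentS iT; apply: leN2_addr.
- by rewrite er.
Qed.

Lemma path_category_is_category : is_category (path_category T t w).
Proof.
split=> /=.
- exact: range_vertex_path.
- exact: source_vertex_path.
- exact: range_composition.
- exact: source_composition.
- by move=> f _; apply: composition_vertex_path_l.
- by move=> f _; apply: composition_vertex_path_r.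
- by move=> f g h fg gh _ _; apply: compositionA.
Qed.

(** * Countability and the factorisation property *)

Lemma tile_path_countable : countable [set: tpath]%classic.
Proof.
apply/countable_injP.
(* A path is determined by its degree and its finite map, and such pairs can be encoded as natural
   numbers. *)
exists (fun l : tpath => choice.pickle (degree l, path_fun l)).
by move=> l l' _ _ /(pcan_inj choice.pickleK)[]; apply: path_inj.
Qed.

(** The factors are the segments of [l] before and after [m], composable because they share the
    window at [m]. The equations defining a composite force any other factors to be these
    segments. *)
Lemma path_factorisation (l : tpath) (m n : N2) : degree l = m + n ->
  exists! p : tpath * tpath,
    [/\ degree p.1 = m, degree p.2 = n &
        path_source p.1 = path_range p.2 /\ l = composition p.1 p.2].
Proof.
move=> d; have ml : leN2 m (degree l) by rewrite d; apply: leN2_addr.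
pose mu := segment_path (leN2_0 m) ml.
pose nu := segment_path ml (leN2_refl _).
have dmu : degree mu = m by exact: subN2_0.
have dnu : degree nu = n by rewrite /= d N2_addKC.
have emu : {in extent T m, ev mu =1 ev l}.
  by move=> i iT; rewrite ev_segment ?subN2_0 // add0r.
have enu : {in extent T n, forall i, ev nu i = ev l (m + i)}.
  by move=> i iT; rewrite ev_segment // d N2_addKC.
have e : path_source mu = path_range nu.
  apply: vertex_ext => i iT; rewrite ev_source // ev_range // dmu emu.
    by rewrite enu ?sub_extent // addrC.
  exact: extent_add.
exists (mu, nu); split.
  split=> //; split=> //; symmetry; apply: composition_eq => //.
  by apply/is_compositionP; rewrite dmu dnu; split=> // i iT; rewrite ?emu ?enu.
move=> [mu' nu'] [/= dmu' dnu' [e' el]].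
have := compositionP e'; rewrite -el => /is_compositionP.
rewrite dmu' dnu' => -[_ h1 h2]; congr pair; apply: path_ext.
- by rewrite dmu'.
- by rewrite dmu => i iT; rewrite emu ?h1.
- by rewrite dnu'.
- by rewrite dnu => i iT; rewrite enu ?h2.
Qed.

End InvertibleCorners.
End TilePaths.

Theorem theorem3p4 (T : {fset N2}) (q : nat) (t : 'Z_q)
    (w : {fmap N2 -> 'Z_q}) :
  basic_data T t w -> invertible_corners T w ->
  (forall mu nu : tile_path T t w, path_source mu = path_range nu ->
     unique (is_composition mu nu) (composition mu nu)) /\
  is_two_graph (C := path_category T t w) (@degree T q t w).
Proof.
move=> [tileT _ domw] cw; split=> [mu nu e|].
  split=> [|l]; first exact: compositionP.
  by apply: composition_unique => //; apply: compositionP.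
split=> //.
- exact: path_category_is_category.
- exact: tile_path_countable.
- by move=> f g e; have [] := compositionP tileT domw cw e.
- move=> l m n /(path_factorisation tileT domw cw)[p [[d1 d2 [e el]] hp]].
  exists p; split=> [|p' [d1' d2' [e' el']]]; first by split=> //; exists e.
  exact: hp.
Qed.
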